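(* Let $F:\mathbb{R}^n\to\mathbb{R}^n$ be monotone, let $K:\mathbb{R}^n\rightrightarrows\mathbb{R}^n$ be inner semicontinuous with closed graph and closed convex values, and let $\bar x$ be a solution of the QVI: find $x\in K(x)$ such that $\langle F(x),z-x\rangle\ge0$ for all $z\in K(x)$. Let $\mu,\mu^\perp>0$ with $\mu\mu^\perp<1$ be such that the mapping $\mathbf{T}(x_1,x_2)=(F(x_1)+N_{K(x_2)}(x_1))\times\{0\}$ is $(\mu^\perp,\mu)$-semimonotone at $((\bar x,\bar x),\mathbf 0)$ on some open set $\mathbf U\subset\mathbb{R}^{2n}\times\mathbb{R}^{2n}$ containing this point, with respect to $\mathbf{S}=\{(x_1,x_2)\in\mathbb{R}^n\times\mathbb{R}^n:x_1=x_2\}$. Let the parameters of Algorithm 2 (see context) satisfy $$r\in(\mu^\perp,1/\mu),\qquad\lambda_x\in(0,2(1-r\mu)),\qquad\lambda_y\in(0,2(1-\mu^\perp/r)).$$ Assume $\mathbf{M^r}$-calmness for this $r$: there exist neighborhoods $V_p'\ni0$, $V_q'\ni\bar x$ and constants $L_p',L_q'\ge0$ such that $\mathbf{M^r}$ is single-valued on $V_p'\times V_q'$ and $\|\mathbf{M^r}(p,q)-\mathbf{M^r}(0,\bar x)\|\le L_p'\|p\|+L_q'\|q-\bar x\|$ for all $(p,q)\in V_p'\times V_q'$. Then the following hold whenever the starting point $(x^0,y^0)$ is close enough to $(\bar x,0)$ (i.e. for all $(x^0,y^0)$ in some neighborhood of $(\bar x,0)$). (i) Suppose there exist neighborhoods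 $V_p\ni0$, $V_q\ni\bar x$ and constants $L_p,L_q\ge0$ with $L_q<1/2$ such that $\mathbf{M}_{\rm VI}$ is single-valued on $V_p\times V_q$ and $\|\mathbf{M}_{\rm VI}(p,q)-\mathbf{M}_{\rm VI}(0,\bar x)\|\le L_p\|p\|+L_q\|q-\bar x\|$ for all $(p,q)\in V_p\times V_q$. Then either a solution of the QVI is reached in a finite number of iterations, or the sequence $\{x^k\}$ generated by Algorithm 2 is bounded and every accumulation point of it is a solution of the QVI. In particular, if $\bar x$ is the unique solution of the QVI in a neighborhood of $\bar x$, then the sequence converges to $\bar x$. (ii) Suppose there exist neighborhoods $V_p\ni0$, $V_q\ni0$ and constants $L_p,L_q\ge0$ with $L_q<1$ such that $\mathbf{M}_{\rm QVI}$ is single-valued on $V_p\times V_q$ and $\|\mathbf{M}_{\rm QVI}(p,q)-\mathbf{M}_{\rm QVI}(0,0)\|\le L_p\|p\|+L_q\|q\|$ for all $(p,q)\in V_p\times V_q$. Then either the solution $\bar x$ is reached in a finite number of iterations, or the generated sequence $\{x^k\}$ converges to the solution $\bar x$ of the QVI (unique in this case).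
   Context: $\|\cdot\|$, $\langle\cdot,\cdot\rangle$ are Euclidean. For a set-valued mapping $\Phi$, $\operatorname{gph}\Phi=\{(x,u):u\in\Phi(x)\}$, $\operatorname{dom}\Phi=\{x:\Phi(x)\ne\emptyset\}$. $K$ is inner semicontinuous if for every $\bar u\in\operatorname{dom}K$, all sequences $u^k\to\bar u$ and every $\bar v\in K(\bar u)$ there is a sequence $v^k\to\bar v$ with $v^k\in K(u^k)$. For a closed convex set $D$, $N_D(x)=\{v:\langle v,y-x\rangle\le0\ \forall y\in D\}$ if $x\in D$ and $N_D(x)=\emptyset$ otherwise. $F$ is monotone if $\langle F(x)-F(y),x-y\rangle\ge0$ for all $x,y$. VI$(G,D)$ is the problem: find $x\in D$ with $\langle G(x),z-x\rangle\ge0$ for all $z\in D$. Solution mappings: for $p,q\in\mathbb{R}^n$, $$x\in\mathbf{M}_{\rm VI}(p,q)\iff 0\in p+F(x)+N_{K(q)}(x),\qquad x\in\mathbf{M}_{\rm QVI}(p,q)\iff0\in p+F(x)+N_{K(x+q)}(x),$$ $$x\in\mathbf{M^r}(p,q)\iff0\in p+F(x)+r(x-\bar x)+N_{K(q)}(x).$$ Single-valued on a set means that the value is a singleton at every point of that set (identified with its element). Semimonotonicity: given $\Phi:\mathbb{R}^m\rightrightarrows\mathbb{R}^m$, a subspace $\mathcal V\subset\mathbb{R}^m$ with orthogonal complement $\mathcal V^\perp$, and $\mu^\perp,\mu>0$, $\Phi$ is $(\mu^\perp,\mu)$-semimonotone (with respect to $\mathcal V$) at $(x^*,y^* )\in\operatorname{gph}\Phi$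 on an open set $\mathcal U\ni(x^*,y^* )$ if for all $(x,y)\in\operatorname{gph}\Phi\cap\mathcal U$ $$\langle y-y^*,x-x^*\rangle+\mu^\perp\|\mathbf P_{\mathcal V^\perp}(x)-\mathbf P_{\mathcal V^\perp}(x^* )\|^2+\mu\|\mathbf P_{\mathcal V}(y)-\mathbf P_{\mathcal V}(y^* )\|^2\ge0,$$ where $\mathbf P$ denotes orthogonal projection. Algorithm 2 (progressive decoupling+ for the QVI), with parameters $r,\lambda_x,\lambda_y>0$: given $x^0,y^0\in\mathbb{R}^n$, for $k=0,1,2,\dots$ set $K^k=K(x^k-\frac1ry^k)$, let $\hat x^k$ be a solution of VI$(G_k,K^k)$ with $G_k(u)=F(u)+ru-y^k-rx^k$, and set $$x^{k+1}=(1-\lambda_x)x^k+\lambda_x\cdot\tfrac12\Bigl(\hat x^k+x^k-\tfrac1ry^k\Bigr),\qquad y^{k+1}=y^k-\lambda_y\cdot\tfrac r2\Bigl(\hat x^k-x^k+\tfrac1ry^k\Bigr).$$ (The stopping test is disregarded when discussing convergence.) In (ii), uniqueness of the solution is understood locally, near $\bar x$. *)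

(* Defs.v *)
From mathcomp Require Export all_boot all_order all_algebra.
From mathcomp Require Export all_classical all_reals all_analysis.

Set Implicit Arguments.
Unset Strict Implicit.
Unset Printing Implicit Defensive.

Export Order.TTheory GRing.Theory Num.Theory.
Export numFieldNormedType.Exports.

Local Open Scope classical_set_scope.
Local Open Scope ring_scope.

(* Row vectors 'rV[R]_n carry the library's topology, induced by the sup norm;
   in finite dimension it is the Euclidean one.  All quantitative estimates use
   the Euclidean norm [enorm] below, never the library norm `|x|. *)
Section Euclidean.
Context {R : realType}.

Definition dotv m (u v : 'rV[R]_m) : R := \sum_(i < m) u 0 i * v 0 i.

Definition enorm m (u : 'rV[R]_m) : R := Num.sqrt (dotv u u).

(* A subspace of R^m is the row space of a square matrix V. *)
Definition orthc m (V : 'M[R]_m) : 'M[R]_m := kermx V^T.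

Definition oproj m (V : 'M[R]_m) (x : 'rV[R]_m) : 'rV[R]_m :=
  x *m proj_mx V (orthc V).

Lemma dotvE m (u v : 'rV[R]_m) : dotv u v = (u *m v^T) 0 0.
Proof. by rewrite mxE; apply: eq_bigr => i _; rewrite mxE. Qed.

Lemma dotv_eq0 m (u : 'rV[R]_m) : dotv u u = 0 -> u = 0.
Proof.
move=> /eqP; rewrite psumr_eq0; last by move=> i _; rewrite -expr2 sqr_ge0.
move=> /allP u0; apply/rowP => i; rewrite mxE; apply/eqP.
by have := u0 i (mem_index_enum _); rewrite /= -expr2 sqrf_eq0.
Qed.

Lemma orthcP m (V : 'M[R]_m) (u : 'rV[R]_m) :
  reflect (forall v : 'rV_m, (v <= V)%MS -> dotv u v = 0) (u <= orthc V)%MS.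
Proof.
apply: (iffP sub_kermxP) => [uV0 v /submxP[w ->]|uV].
  by rewrite dotvE trmx_mul mulmxA uV0 mul0mx mxE.
apply/rowP => j; rewrite [RHS]mxE -(uV _ (row_sub j V)) dotvE !mxE.
by apply: eq_bigr => k _; rewrite !mxE.
Qed.

Lemma orthc_cap0 m (V : 'M[R]_m) : (V :&: orthc V = 0)%MS.
Proof.
apply/eqP/rowV0P => v; rewrite sub_capmx => /andP[vV /orthcP vO].
exact/dotv_eq0/vO.
Qed.

Lemma orthc_add1 m (V : 'M[R]_m) : (V + orthc V :=: 1%:M)%MS.
Proof.
apply/eqmxP; rewrite submx1 sub1mx -col_leq_rank.
have := mxrank_sum_cap V (orthc V); rewrite orthc_cap0 mxrank0 addn0 => ->.
by rewrite /orthc mxrank_ker mxrank_tr subnKC ?leqnn ?rank_leq_row.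
Qed.

(* [oproj V] is the orthogonal projection onto V. *)
Lemma oproj_spec m (V : 'M[R]_m) (x : 'rV[R]_m) :
  (oproj V x <= V)%MS /\ (x - oproj V x <= orthc V)%MS.
Proof.
by rewrite /oproj proj_mx_sub proj_mx_compl_sub // orthc_add1 submx1.
Qed.

(* S = {(x1, x2) | x1 = x2}, with (x1, x2) encoded as row_mx x1 x2. *)
Definition diag_space n : 'M[R]_(n + n) := kermx (col_mx 1%:M (- 1%:M)).

Lemma diag_spaceP n (x : 'rV[R]_(n + n)) :
  reflect (lsubmx x = rsubmx x) (x <= diag_space n)%MS.
Proof.
rewrite -[x in (x <= _)%MS]hsubmxK; apply: (iffP sub_kermxP).
  by rewrite mul_row_col mulmxN !mulmx1 => /eqP; rewrite subr_eq0 => /eqP.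
by rewrite mul_row_col mulmxN !mulmx1 => ->; rewrite subrr.
Qed.

End Euclidean.

Section SetValued.
Context {R : realType}.

Definition gph m p (Phi : 'rV[R]_m -> set 'rV[R]_p) : set ('rV[R]_m * 'rV[R]_p) :=
  [set z | Phi z.1 z.2].

Definition dom m p (Phi : 'rV[R]_m -> set 'rV[R]_p) : set 'rV[R]_m :=
  [set x | Phi x !=set0].

(* Membership is required for all large k, as in the usual sequential inner
   limit.  Requiring it for every k would force K to be nonempty-valued
   everywhere (finitely many terms of a convergent sequence are arbitrary). *)
Definition inner_semicontinuous m p (K : 'rV[R]_m -> set 'rV[R]_p) :=
  forall (ubar : 'rV[R]_m) (u : nat -> 'rV[R]_m) (vbar : 'rV[R]_p),
    dom K ubar -> u @ \oo --> ubar -> K ubar vbar ->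
    exists v : nat -> 'rV[R]_p,
      v @ \oo --> vbar /\ \forall k \near \oo, K (u k) (v k).

Definition monotone_map m (F : 'rV[R]_m -> 'rV[R]_m) :=
  forall x y, 0 <= dotv (F x - F y) (x - y).

Definition normal_cone m (D : set 'rV[R]_m) (x : 'rV[R]_m) : set 'rV[R]_m :=
  [set v | D x /\ forall y, D y -> dotv v (y - x) <= 0].

Definition plus_normal_cone m (G : 'rV[R]_m -> 'rV[R]_m) (D : set 'rV[R]_m)
    (x : 'rV[R]_m) : set 'rV[R]_m :=
  [set G x + v | v in normal_cone D x].

Definition semimonotone m (Phi : 'rV[R]_m -> set 'rV[R]_m) (V : 'M[R]_m)
    (mu_perp mu : R) (xs ys : 'rV[R]_m) (U : set ('rV[R]_m * 'rV[R]_m)) :=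
  [/\ gph Phi (xs, ys), open U, U (xs, ys) &
   forall x y, gph Phi (x, y) -> U (x, y) ->
     0 <= dotv (y - ys) (x - xs)
          + mu_perp * enorm (oproj (orthc V) x - oproj (orthc V) xs) ^+ 2
          + mu * enorm (oproj V y - oproj V ys) ^+ 2].

End SetValued.

Section QVI.
Context {R : realType} {n : nat}.
Implicit Types (F G : 'rV[R]_n -> 'rV[R]_n) (D : set 'rV[R]_n).
Implicit Types (K : 'rV[R]_n -> set 'rV[R]_n) (p q xbar : 'rV[R]_n).

Definition VI_sol G D : set 'rV[R]_n :=
  [set x | D x /\ forall z, D z -> 0 <= dotv (G x) (z - x)].

Definition QVI_sol F K : set 'rV[R]_n := [set x | VI_sol F (K x) x].

Definition M_VI F K p q : set 'rV[R]_n :=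
  [set x | plus_normal_cone (fun u => p + F u) (K q) x 0].

Definition M_QVI F K p q : set 'rV[R]_n :=
  [set x | plus_normal_cone (fun u => p + F u) (K (x + q)) x 0].

Definition M_reg F K r xbar p q : set 'rV[R]_n :=
  [set x | plus_normal_cone (fun u => p + F u + r *: (u - xbar)) (K q) x 0].

(* T(x1, x2) = (F(x1) + N_{K(x2)}(x1)) x {0} *)
Definition T_map F K (x : 'rV[R]_(n + n)) : set 'rV[R]_(n + n) :=
  [set row_mx w 0 | w in plus_normal_cone F (K (rsubmx x)) (lsubmx x)].

(* Calmness at (0, q0), with constants Lp and Lq, of a mapping which is
   single-valued on a product of neighborhoods of 0 and q0. *)
Definition single_valued_calm (M : 'rV[R]_n -> 'rV[R]_n -> set 'rV[R]_n)
    q0 (Lp Lq : R) :=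
  exists Vp Vq : set 'rV[R]_n,
    [/\ nbhs (0 : 'rV[R]_n) Vp, nbhs q0 Vq,
        forall p q, Vp p -> Vq q -> exists x, M p q = [set x] &
        forall p q x x0, Vp p -> Vq q -> M p q = [set x] -> M 0 q0 = [set x0] ->
          enorm (x - x0) <= Lp * enorm p + Lq * enorm (q - q0)].

(* (x, y) are iterates of the algorithm started at (x0, y0), with successive
   choices xh of solutions of the subproblems. *)
Definition pdQVI_run F K (r lx ly : R) (x0 y0 : 'rV[R]_n)
    (x y xh : nat -> 'rV[R]_n) :=
  [/\ x 0%N = x0, y 0%N = y0 &
   forall k,
   [/\ VI_sol (fun u => F u + r *: u - y k - r *: x k)
              (K (x k - r^-1 *: y k)) (xh k),
       x k.+1 = (1 - lx) *: x k
                + lx *: (2^-1 *: (xh k + x k - r^-1 *: y k)) &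
       y k.+1 = y k - ly *: ((r / 2) *: (xh k - x k + r^-1 *: y k))]].

End QVI.

(* Main.v *)
Require Import Defs.
From mathcomp Require Import ring lra.

Set Implicit Arguments.
Unset Strict Implicit.
Unset Printing Implicit Defensive.

(** At an iterate [(x, y)] with subproblem solution [xh], put
    [a = xh - x - y / r] and [b = xh - x + y / r].  The update is then
    [x += (lx / 2) a] and [y -= (ly r / 2) b], and [xh] satisfies
    [- r a \in F xh + N_(K (xh - b)) xh].  The inclusion is that of the
    operator [T] at the pair [(xh, xh - b)], so, as long as this pair and [r a]
    stay close to [(xbar, xbar)] and [0], semimonotonicity gives
      [<- r a, xh - xbar> + (mu_perp / 2) |b|^2 + (mu r^2 / 2) |a|^2 >= 0].
    Expanding squares, this says exactly that the Lyapunov function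
    [|x - xbar|^2 / lx + |y|^2 / (r^2 ly)] decreases in one step by at least
      [(2 (1 - r mu) - lx) / 4 |a|^2 + (2 (1 - mu_perp / r) - ly) / 4 |b|^2]
    ([lyapunov_step]), both coefficients being positive by the choice of [lx]
    and [ly].

    Calmness of the regularized mapping [M_reg] localizes the argument
    ([subproblem_local]): near [(xbar, 0)] the subproblem is solvable and all its
    solutions are close to [xbar].  As sublevel sets of the Lyapunov function are
    small neighborhoods of [(xbar, 0)] and each step stays in the sublevel set it
    starts from, runs exist and never leave the region where the descent
    inequality is valid ([local_descent], [run_exists]).

    It remains to convert descent into convergence.  The inclusion also reads
    [xh \in M_VI (r a) (xh - b)] and [xh \in M_QVI (r a) (- b)].  Calmness of
    [M_VI] gives [|xh - xbar| <= Lp r |a| + Lq (|xh - xbar| + |b|)], in which the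
    term [Lq |xh - xbar|] is absorbed as soon as [Lq < 1]; calmness of [M_QVI]
    gives [|xh - xbar| <= Lp r |a| + Lq |b|] directly.  Either way
    [|x - xbar|^2] is bounded by a multiple of the Lyapunov decrease, which
    tends to [0] along a run since the Lyapunov function is nonincreasing and
    nonnegative ([run_cvg]).  Thus in both cases the whole sequence converges to
    [xbar], which is stronger than the alternatives of the statement; in
    particular [xbar] is the only accumulation point. *)

Local Open Scope classical_set_scope.
Local Open Scope ring_scope.

(** * Euclidean geometry of row vectors *)
Section EuclideanTheory.
Context {R : realType} {m : nat}.
Implicit Types (u v w : 'rV[R]_m) (a : R).

Lemma dotvC u v : dotv u v = dotv v u.
Proof. by apply: eq_bigr => i _; rewrite mulrC. Qed.

Lemma dotvDl u v w : dotv (u + v) w = dotv u w + dotv v w.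
Proof. by rewrite -big_split; apply: eq_bigr => i _; rewrite mxE mulrDl. Qed.

Lemma dotvZl a u v : dotv (a *: u) v = a * dotv u v.
Proof. by rewrite mulr_sumr; apply: eq_bigr => i _; rewrite mxE mulrA. Qed.

Lemma dotvDr u v w : dotv w (u + v) = dotv w u + dotv w v.
Proof. by rewrite dotvC dotvDl !(dotvC w). Qed.

Lemma dotvZr a u v : dotv u (a *: v) = a * dotv u v.
Proof. by rewrite dotvC dotvZl dotvC. Qed.

Lemma dotvNl u v : dotv (- u) v = - dotv u v.
Proof. by rewrite -scaleN1r dotvZl mulN1r. Qed.

Lemma dotvNr u v : dotv u (- v) = - dotv u v.
Proof. by rewrite dotvC dotvNl dotvC. Qed.

Lemma dotv0 u : dotv 0 u = 0.
Proof. by rewrite -(scale0r 0) dotvZl mul0r. Qed.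

Definition dotv_bilinear := (dotvDl, dotvDr, dotvZl, dotvZr, dotvNl, dotvNr).

Lemma dotv_ge0 u : 0 <= dotv u u.
Proof. by apply: sumr_ge0 => i _; rewrite -expr2 sqr_ge0. Qed.

Lemma enorm_ge0 u : 0 <= enorm u.
Proof. exact: sqrtr_ge0. Qed.

Lemma sqr_enorm u : enorm u ^+ 2 = dotv u u.
Proof. by rewrite sqr_sqrtr ?dotv_ge0. Qed.

Lemma enorm0 : enorm (0 : 'rV[R]_m) = 0.
Proof. by rewrite /enorm dotv0 sqrtr0. Qed.

Lemma enorm_eq0 u : enorm u = 0 -> u = 0.
Proof. by move=> u0; apply: dotv_eq0; rewrite -sqr_enorm u0 expr0n. Qed.

Lemma enormZ a u : enorm (a *: u) = `|a| * enorm u.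
Proof.
by rewrite /enorm dotvZl dotvZr mulrA -expr2 sqrtrM ?sqr_ge0 // sqrtr_sqr.
Qed.

Lemma enormN u : enorm (- u) = enorm u.
Proof. by rewrite -scaleN1r enormZ normrN1 mul1r. Qed.

Lemma cauchy_schwarz u v : dotv u v <= enorm u * enorm v.
Proof.
have [u0|u_neq0] := eqVneq (enorm u) 0.
  by rewrite (enorm_eq0 u0) dotv0 enorm0 mul0r.
have [v0|v_neq0] := eqVneq (enorm v) 0.
  by rewrite (enorm_eq0 v0) dotvC dotv0 enorm0 mulr0.
have uv_gt0 : 0 < enorm u * enorm v.
  by rewrite mulr_gt0 ?lt0r ?u_neq0 ?v_neq0 ?enorm_ge0.
have := dotv_ge0 (enorm v *: u - enorm u *: v).
rewrite !dotv_bilinear (dotvC v u) -!sqr_enorm => h.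
rewrite -(ler_pM2l uv_gt0); lra.
Qed.

Lemma enormD u v : enorm (u + v) <= enorm u + enorm v.
Proof.
rewrite -(ler_pXn2r (n := 2)) ?nnegrE ?addr_ge0 ?enorm_ge0 //.
rewrite sqr_enorm !dotv_bilinear (dotvC v u) sqrrD !sqr_enorm.
by have := cauchy_schwarz u v; lra.
Qed.

Lemma enormB u v : enorm (u - v) <= enorm u + enorm v.
Proof. by rewrite (le_trans (enormD _ _)) // enormN. Qed.

Lemma norm_coord_le_enorm u j : `|u 0 j| <= enorm u.
Proof.
rewrite -[`|_|]sqrtr_sqr ler_wsqrtr // /dotv (bigD1 j) //= -expr2.
by rewrite lerDl; apply: sumr_ge0 => i _; rewrite -expr2 sqr_ge0.
Qed.

(** The topology of row vectors comes from the sup norm, which is at most the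
    Euclidean norm; conversely a Euclidean ball of radius [e] contains the sup
    ball of radius [e / (m + 1)], as [m / (m + 1)^2 < 1]. *)
Lemma nbhs_enorm u (A : set 'rV[R]_m) :
  nbhs u A <-> exists2 e : R, 0 < e & forall x, enorm (x - u) < e -> A x.
Proof.
split=> [/nbhs_ballP[e /= e_gt0 ballA]|[e e_gt0 ballA]].
  exists e => // x xu; apply: ballA; split=> // i j.
  rewrite ord1 -ball_normE /= distrC (le_lt_trans _ xu) //.
  by have := norm_coord_le_enorm (x - u) j; rewrite !mxE.
apply/nbhs_ballP.
have d_gt0 : 0 < e / m.+1%:R by rewrite divr_gt0 ?ltr0Sn.
exists (e / m.+1%:R) => //= x [_ xu]; apply: ballA.
rewrite -(ltr_pXn2r (n := 2)) ?nnegrE ?enorm_ge0 ?(ltW e_gt0) // sqr_enorm.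
apply: (@le_lt_trans _ _ (\sum_(i < m) (e / m.+1%:R) ^+ 2)).
  apply: ler_sum => i _; have := xu 0 i; rewrite -ball_normE /= => h.
  rewrite -expr2 !mxE -real_normK ?num_real // distrC.
  by rewrite lerXn2r ?nnegrE ?normr_ge0 ?(ltW h) ?(ltW d_gt0).
rewrite sumr_const card_ord exprMn -[ltLHS]mulr_natr -mulrA -[ltRHS]mulr1.
rewrite ltr_pM2l ?exprn_gt0 // exprVn mulrC ltr_pdivrMr ?exprn_gt0 ?ltr0Sn //.
by rewrite mul1r -natrX ltr_nat -mulnn mulnS ltn_addr.
Qed.
End EuclideanTheory.

(** * Orthogonal projections and the diagonal subspace *)
Section Projections.
Context {R : realType}.

Lemma oproj_unique m (V : 'M[R]_m) (x v : 'rV[R]_m) :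
  (v <= V)%MS -> (x - v <= orthc V)%MS -> oproj V x = v.
Proof.
move=> vV xvO; rewrite -[x in LHS](subrK v) /oproj mulmxDl.
by rewrite proj_mx_0 ?orthc_cap0 // proj_mx_id ?orthc_cap0 // add0r.
Qed.

Lemma oproj_orthc m (V : 'M[R]_m) (x : 'rV[R]_m) :
  oproj (orthc V) x = x - oproj V x.
Proof.
have [xV xO] := oproj_spec V x.
apply: oproj_unique => //; rewrite subKr; apply/orthcP => v /orthcP vO.
by rewrite dotvC vO.
Qed.

Lemma dotv_row_mx m p (u v : 'rV[R]_m) (u' v' : 'rV[R]_p) :
  dotv (row_mx u u') (row_mx v v') = dotv u v + dotv u' v'.
Proof. by rewrite !dotvE tr_row_mx mul_row_col mxE. Qed.

Lemma enorm_row_mx m p (u : 'rV[R]_m) (v : 'rV[R]_p) :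
  enorm (row_mx u v) <= enorm u + enorm v.
Proof.
rewrite -(ler_pXn2r (n := 2)) ?nnegrE ?addr_ge0 ?enorm_ge0 //.
rewrite sqr_enorm dotv_row_mx sqrrD !sqr_enorm.
by have := mulr_ge0 (enorm_ge0 u) (enorm_ge0 v); lra.
Qed.

Lemma oproj_diag_space n (u v : 'rV[R]_n) :
  oproj (diag_space n) (row_mx u v) =
  row_mx (2^-1 *: (u + v)) (2^-1 *: (u + v)).
Proof.
apply: oproj_unique; first by apply/diag_spaceP; rewrite row_mxKl row_mxKr.
apply/orthcP => x /diag_spaceP x12.
rewrite -[x]hsubmxK -x12 opp_row_mx add_row_mx dotv_row_mx !dotv_bilinear.
by lra.
Qed.

Lemma oproj_diag_space_orthc n (u v : 'rV[R]_n) :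
  oproj (orthc (diag_space n)) (row_mx u v) =
  row_mx (2^-1 *: (u - v)) (2^-1 *: (v - u)).
Proof.
rewrite oproj_orthc oproj_diag_space opp_row_mx add_row_mx.
by congr row_mx; apply/rowP => i; rewrite !mxE; field.
Qed.

End Projections.

(** * Variational inequalities as inclusions *)
Section Inclusions.
Context {R : realType} {n : nat}.
Implicit Types (F G : 'rV[R]_n -> 'rV[R]_n) (D : set 'rV[R]_n).
Implicit Types (K : 'rV[R]_n -> set 'rV[R]_n) (p q w x y xh xbar : 'rV[R]_n).

Lemma plus_normal_coneP G D x w :
  plus_normal_cone G D x w <->
  (D x /\ forall z, D z -> 0 <= dotv (G x - w) (z - x)).
Proof.
split=> [[v [Dx vN] <-]|[Dx wN]].
  split=> // z Dz; rewrite opprD addNKr dotvNl oppr_ge0; exact: vN.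
exists (w - G x); last by rewrite addrC subrK.
by split=> // z Dz; rewrite -opprB dotvNl oppr_le0; apply: wN.
Qed.

(** Membership in a normal-cone inclusion at [x] involves the map only through
    its value at [x]; this turns a solution of a subproblem into a point of each
    of the solution mappings, for suitable perturbations. *)
Lemma VI_sol_plus_normal_cone G G' D x w : G x = G' x - w ->
  VI_sol G D x <-> plus_normal_cone G' D x w.
Proof. by rewrite plus_normal_coneP => <-. Qed.

(** On the diagonal the projection of [(w, 0)] is [(w / 2, w / 2)], and on its
    complement that of [(x1, x2)] is [((x1 - x2) / 2, (x2 - x1) / 2)]; their
    squared norms [|w|^2 / 2] and [|x1 - x2|^2 / 2] account for the halves. *)
Lemma semimonotone_local F K xbar (mu mu_perp : R) U :
    semimonotone (T_map F K) (diag_space n) mu_perp mu (row_mx xbar xbar) 0 U ->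
  exists2 e : R, 0 < e & forall x1 x2 w, plus_normal_cone F (K x2) x1 w ->
    enorm (x1 - xbar) < e -> enorm (x2 - xbar) < e -> enorm w < e ->
    0 <= dotv w (x1 - xbar) + mu_perp / 2 * dotv (x1 - x2) (x1 - x2)
         + mu / 2 * dotv w w.
Proof.
move=> [_ openU Ux ineqU].
have : nbhs (row_mx xbar xbar, 0 : 'rV[R]_(n + n)) U by exact: open_nbhs_nbhs.
move=> [[A B] /= [/nbhs_enorm[e e_gt0 eA] /nbhs_enorm[d d_gt0 dB]] ABU].
(* [e / 2]: the pair is within the sum of the distances of its components. *)
exists (Num.min (e / 2) d); first by rewrite lt_min d_gt0 divr_gt0.
move=> x1 x2 w Tw; rewrite !lt_min => /andP[x1e _] /andP[x2e _] /andP[_ wd].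
have Tgph : gph (T_map F K) (row_mx x1 x2, row_mx w 0).
  by exists w; rewrite //= row_mxKl row_mxKr.
have /(ineqU _ _ Tgph) : U (row_mx x1 x2, row_mx w 0).
  apply: ABU; split=> /=.
    apply: eA; rewrite opp_row_mx add_row_mx.
    by apply: le_lt_trans (enorm_row_mx _ _) _; lra.
  apply: dB; rewrite subr0; apply: le_lt_trans wd.
  by rewrite (le_trans (enorm_row_mx _ _)) // enorm0 addr0.
rewrite subr0 opp_row_mx add_row_mx dotv_row_mx -row_mx0.
rewrite !oproj_diag_space !oproj_diag_space_orthc !opp_row_mx !add_row_mx.
rewrite !sqr_enorm !dotv_row_mx !subrr !addr0 !scaler0 !subr0 -(opprB x1 x2).
rewrite dotv0 !scalerN !dotvNl !dotvNr !dotvZl !dotvZr.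
by lra.
Qed.

Lemma calm_bound (M : 'rV[R]_n -> 'rV[R]_n -> set 'rV[R]_n) q0 (Lp Lq : R) x0 :
    single_valued_calm M q0 Lp Lq -> M 0 q0 x0 ->
  exists2 e : R, 0 < e & forall p q, enorm p < e -> enorm (q - q0) < e ->
    M p q !=set0 /\
    forall x, M p q x -> enorm (x - x0) <= Lp * enorm p + Lq * enorm (q - q0).
Proof.
move=> [Vp [Vq [nVp nVq sval calm]]] Mx0.
move: (nVp) (nVq) => /nbhs_enorm[e e_gt0 eV] /nbhs_enorm[d d_gt0 dV].
exists (Num.min e d) => [|p q]; first by rewrite lt_min e_gt0.
rewrite !lt_min => /andP[pe _] /andP[_ qd].
have Vpp : Vp p by apply: eV; rewrite subr0.
have Vqq : Vq q by apply: dV.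
have [x Mx] := sval p q Vpp Vqq.
have [x' Mx'] := sval 0 q0 (nbhs_singleton nVp) (nbhs_singleton nVq).
rewrite Mx' in Mx0; rewrite -Mx0 in Mx'.
split; first by exists x; rewrite Mx.
by move=> z; rewrite Mx => ->; apply: (calm p q) Mx Mx'.
Qed.

End Inclusions.

(** * The subproblem and the update directions *)
Section Step.
Context {R : realType} {n : nat}.
Context (F : 'rV[R]_n -> 'rV[R]_n) (K : 'rV[R]_n -> set 'rV[R]_n).
Context (xbar : 'rV[R]_n) (r lx ly : R).
Context (r_gt0 : 0 < r) (lx_gt0 : 0 < lx) (ly_gt0 : 0 < ly).
Implicit Types (x y xh : 'rV[R]_n).

Definition subproblem x y : set 'rV[R]_n :=
  VI_sol (fun u => F u + r *: u - y - r *: x) (K (x - r^-1 *: y)).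

Definition primal_dir x y xh : 'rV[R]_n := xh - x - r^-1 *: y.

Definition dual_dir x y xh : 'rV[R]_n := xh - x + r^-1 *: y.

Definition next_x x y xh : 'rV[R]_n := x + (lx / 2) *: primal_dir x y xh.

Definition next_y x y xh : 'rV[R]_n := y - (ly * r / 2) *: dual_dir x y xh.

Lemma dual_dirE x y xh : xh - dual_dir x y xh = x - r^-1 *: y.
Proof. by rewrite /dual_dir; apply/rowP => i; rewrite !mxE; ring. Qed.

Lemma sub_primal_dir x y xh :
  xh - x = 2^-1 *: (primal_dir x y xh + dual_dir x y xh).
Proof.
by apply/rowP => i; rewrite /primal_dir /dual_dir !mxE; field; rewrite gt_eqF.
Qed.

(** This is where [M_reg] controls the algorithm: the perturbation
    [(r (xbar - x) - y, x - y / r)] tends to [(0, xbar)] with [(x, y)]. *)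
Lemma subproblem_regularized x y xh :
  subproblem x y xh <->
  M_reg F K r xbar (r *: (xbar - x) - y) (x - r^-1 *: y) xh.
Proof.
refine (@VI_sol_plus_normal_cone _ _ _
  (fun u => r *: (xbar - x) - y + F u + r *: (u - xbar)) _ _ _ _).
by rewrite subr0; apply/rowP => i; rewrite !mxE; ring.
Qed.

(** The directions of the two updates measure by how much [xh] fails to solve
    the QVI: they are the residual of the inclusion and the displacement of the
    argument of [K]. *)
Lemma subproblem_inclusion x y xh : subproblem x y xh ->
  plus_normal_cone F (K (xh - dual_dir x y xh)) xh (- (r *: primal_dir x y xh)).
Proof.
rewrite dual_dirE; apply/(iffLR (VI_sol_plus_normal_cone _ _)).
by apply/rowP => i; rewrite /primal_dir !mxE; field; rewrite gt_eqF.
Qed.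

Lemma subproblem_VI x y xh : subproblem x y xh ->
  M_VI F K (r *: primal_dir x y xh) (xh - dual_dir x y xh) xh.
Proof.
move=> /subproblem_inclusion/plus_normal_coneP[Kxh ineq].
by apply/plus_normal_coneP; split=> // z /ineq; rewrite opprK subr0 addrC.
Qed.

(** [M_QVI] shifts its argument by the second perturbation, so [- dual_dir]
    places the constraint set at [xh - dual_dir], as for [M_VI]. *)
Lemma subproblem_QVI x y xh : subproblem x y xh ->
  M_QVI F K (r *: primal_dir x y xh) (- dual_dir x y xh) xh.
Proof. exact: subproblem_VI. Qed.

(** * The Lyapunov function *)

(** Weighting the primal and dual errors by the step sizes makes the linear terms
    of the two updates combine into the inner product that semimonotonicity
    controls. *)
Definition lyapunov x y : R :=
  dotv (x - xbar) (x - xbar) / lx + dotv y y / (r ^+ 2 * ly).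

Lemma lyapunov_ge0 x y : 0 <= lyapunov x y.
Proof.
by rewrite addr_ge0 // divr_ge0 ?dotv_ge0 ?mulr_ge0 ?exprn_ge0 // ltW.
Qed.

(** Together with [lyapunov_near], this makes the sublevel sets of the Lyapunov
    function a neighborhood basis of [(xbar, 0)], well suited to the algorithm
    because the small ones are preserved by its steps. *)
Lemma lyapunov_small e : 0 < e ->
  exists2 d : R, 0 < d &
    forall x y, lyapunov x y < d -> enorm (x - xbar) < e /\ enorm y < e.
Proof.
move=> e_gt0; have e2_gt0 := exprn_gt0 2 e_gt0.
have rl_gt0 : 0 < r ^+ 2 * ly by rewrite mulr_gt0 ?exprn_gt0.
exists (Num.min (e ^+ 2 / lx) (e ^+ 2 / (r ^+ 2 * ly))).
  by rewrite lt_min !divr_gt0.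
move=> x y; rewrite lt_min => /andP[h1 h2].
have hx : 0 <= dotv (x - xbar) (x - xbar) / lx.
  by rewrite divr_ge0 ?dotv_ge0 ?ltW.
have hy : 0 <= dotv y y / (r ^+ 2 * ly) by rewrite divr_ge0 ?dotv_ge0 ?ltW.
split; rewrite -(ltr_pXn2r (n := 2)) ?nnegrE ?enorm_ge0 ?(ltW e_gt0) //.
  rewrite sqr_enorm -(ltr_pM2r (x := lx^-1)) ?invr_gt0 //.
  by apply: le_lt_trans h1; rewrite lerDl.
rewrite sqr_enorm -(ltr_pM2r (x := (r ^+ 2 * ly)^-1)) ?invr_gt0 //.
by apply: le_lt_trans h2; rewrite lerDr.
Qed.

(** The identities [xh - xbar = (x - xbar) + (a + b) / 2] and
    [y = (r / 2) (b - a)] reduce everything to quadratic forms in [x - xbar],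
    [a] and [b]. *)
Lemma lyapunov_step (mu mu_perp : R) x y xh :
  let a := primal_dir x y xh in let b := dual_dir x y xh in
  0 <= dotv (- (r *: a)) (xh - xbar) + mu_perp / 2 * dotv b b
       + mu / 2 * dotv (- (r *: a)) (- (r *: a)) ->
  lyapunov (next_x x y xh) (next_y x y xh) <=
  lyapunov x y - ((2 * (1 - r * mu) - lx) / 4 * dotv a a
                  + (2 * (1 - mu_perp / r) - ly) / 4 * dotv b b).
Proof.
move=> a b.
have xhE : xh - xbar = (x - xbar) + 2^-1 *: (a + b).
  by rewrite -sub_primal_dir; apply/rowP => i; rewrite !mxE; ring.
have yE : y = (r / 2) *: (b - a).
  apply/rowP => i; rewrite /a /b /primal_dir /dual_dir !mxE.
  by field; rewrite gt_eqF.
have -> : lyapunov (next_x x y xh) (next_y x y xh) =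
    dotv (x - xbar + (lx / 2) *: a) (x - xbar + (lx / 2) *: a) / lx
    + dotv (y - (ly * r / 2) *: b) (y - (ly * r / 2) *: b) / (r ^+ 2 * ly).
  by rewrite /lyapunov /next_x /next_y [x + _ - _]addrAC.
clearbody a b.
rewrite /lyapunov yE xhE -(pmulr_rge0 (x := r^-1)) ?invr_gt0 // => ineq.
move: (x - xbar) ineq => e; rewrite !dotv_bilinear (dotvC a e) (dotvC b a).
set ea := dotv e a; set ee := dotv e e; set aa := dotv a a.
set ab := dotv a b; set bb := dotv b b => ineq.
(* After division by [r], the assumed quantity is the gap to be shown
   nonnegative, as an identity between the five inner products. *)
rewrite -subr_ge0; apply: le_trans ineq _; rewrite le_eqVlt; apply/orP; left.
by apply/eqP; field; rewrite !gt_eqF.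
Qed.

Lemma lyapunov_near d : 0 < d ->
  \forall z \near (xbar, 0 : 'rV[R]_n), lyapunov z.1 z.2 < d.
Proof.
move=> d_gt0; have rl_gt0 : 0 < r ^+ 2 * ly by rewrite mulr_gt0 ?exprn_gt0.
exists ([set x | enorm (x - xbar) < Num.sqrt (d / 2 * lx)],
        [set y | enorm y < Num.sqrt (d / 2 * (r ^+ 2 * ly))]) => /=.
  split; apply/nbhs_enorm.
    exists (Num.sqrt (d / 2 * lx)) => //.
    by rewrite sqrtr_gt0 mulr_gt0 ?divr_gt0.
  exists (Num.sqrt (d / 2 * (r ^+ 2 * ly))).
    by rewrite sqrtr_gt0 mulr_gt0 ?divr_gt0.
  by move=> y; rewrite subr0.
move=> [x y] /= [].
rewrite !ltr_sqrt ?mulr_gt0 ?divr_gt0 // => hx hy.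
by rewrite /lyapunov [d]splitr ltrD // ltr_pdivrMr.
Qed.

(** * Behavior of a step near the solution *)

Definition local_solvability : Prop :=
  forall e : R, 0 < e -> exists2 d : R, 0 < d & forall x y, lyapunov x y < d ->
    subproblem x y !=set0 /\
    forall xh, subproblem x y xh ->
      [/\ enorm (xh - xbar) < e, enorm (xh - dual_dir x y xh - xbar) < e,
          enorm (r *: primal_dir x y xh) < e & enorm (dual_dir x y xh) < e].

(** If [x - xbar] and [y] have norm at most [t], calmness of [M_reg] bounds each
    quantity of [local_solvability] by a constant multiple of [t]. *)
Lemma subproblem_local (Lp Lq : R) : 0 <= Lp -> 0 <= Lq ->
  single_valued_calm (M_reg F K r xbar) xbar Lp Lq -> QVI_sol F K xbar ->
  local_solvability.
Proof.
move=> Lp_ge0 Lq_ge0 calm sol e e_gt0.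
have Mbar : M_reg F K r xbar 0 xbar xbar.
  apply/plus_normal_coneP; rewrite add0r subrr scaler0 addr0 subr0; exact: sol.
have [e0 e0_gt0 bnd] := calm_bound calm Mbar.
have ri_gt0 : 0 < r^-1 by rewrite invr_gt0.
have [cp cpE] : exists c, c = r + 1 by eexists.
have [cq cqE] : exists c, c = 1 + r^-1 by eexists.
have [cL cLE] : exists c, c = Lp * cp + Lq * cq by eexists.
(* Strictly larger than the factors in all the bounds used below; the leading
   [1] turns the large inequalities into strict ones. *)
pose C := 1 + cp + cq + cL + (1 + r + r * cL) + (cL + cq).
have cp_ge0 : 0 <= cp by rewrite cpE addr_ge0 // ltW.
have cq_ge0 : 0 <= cq by rewrite cqE addr_ge0 // ltW.
have cL_ge0 : 0 <= cL by rewrite cLE addr_ge0 // mulr_ge0.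
have rcL_ge0 : 0 <= r * cL by rewrite mulr_ge0 // ltW.
have C_gt0 : 0 < C by rewrite /C; lra.
have m_gt0 : 0 < Num.min e e0 by rewrite lt_min e_gt0.
have t_gt0 : 0 < Num.min e e0 / C by rewrite divr_gt0.
have [d d_gt0 small] := lyapunov_small t_gt0.
exists d => // x y /small[]; set t := Num.min e e0 / C => xt yt.
have lt_e (c u : R) : c < C -> u <= c * t -> u < e /\ u < e0.
  move=> cC ut; apply/andP; rewrite -lt_min (le_lt_trans ut) //.
  by rewrite -[ltRHS](divfK (lt0r_neq0 C_gt0)) [ltRHS]mulrC ltr_pM2r.
clearbody t.
have pt : enorm (r *: (xbar - x) - y) <= cp * t.
  rewrite (le_trans (enormB _ _)) // enormZ gtr0_norm // -enormN opprB.
  have : r * enorm (x - xbar) <= r * t by rewrite ler_pM2l // ltW.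
  by rewrite cpE; lra.
have qt : enorm (x - r^-1 *: y - xbar) <= cq * t.
  rewrite addrAC (le_trans (enormB _ _)) // enormZ gtr0_norm //.
  have : r^-1 * enorm y <= r^-1 * t by rewrite ler_pM2l // ltW.
  by rewrite cqE mulrDl mul1r => h; rewrite lerD // ltW.
have pe0 : enorm (r *: (xbar - x) - y) < e0.
  by apply: (proj2 (lt_e _ _ _ pt)); rewrite /C; lra.
have qe0 : enorm (x - r^-1 *: y - xbar) < e0.
  by apply: (proj2 (lt_e _ _ _ qt)); rewrite /C; lra.
have [[xh0 Mxh0] calmM] := bnd _ _ pe0 qe0.
split; first by exists xh0; apply/subproblem_regularized.
move=> xh sub; have := calmM xh (iffLR (subproblem_regularized _ _ _) sub).
move=> {sub} xhb.
have xht : enorm (xh - xbar) <= cL * t.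
  apply: (le_trans xhb); rewrite cLE mulrDl -!mulrA.
  by rewrite lerD // ler_wpM2l.
have at_ : enorm (r *: primal_dir x y xh) <= (1 + r + r * cL) * t.
  have -> : r *: primal_dir x y xh = r *: (xh - xbar) - (r *: (x - xbar) + y).
    by apply/rowP => i; rewrite /primal_dir !mxE; field; rewrite gt_eqF.
  have := enormB (r *: (xh - xbar)) (r *: (x - xbar) + y).
  have := enormD (r *: (x - xbar)) y; rewrite !enormZ gtr0_norm //.
  have : r * enorm (x - xbar) <= r * t by rewrite ler_pM2l // ltW.
  have : r * enorm (xh - xbar) <= r * (cL * t) by rewrite ler_pM2l // ltW.
  by lra.
have bt : enorm (dual_dir x y xh) <= (cL + cq) * t.
  have -> : dual_dir x y xh = xh - xbar - (x - r^-1 *: y - xbar).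
    by rewrite -(dual_dirE x y xh) opprB addrA subrK subKr.
  by rewrite (le_trans (enormB _ _)) // mulrDl lerD.
rewrite dual_dirE; split.
- by apply: (proj1 (lt_e _ _ _ xht)); rewrite /C; lra.
- by apply: (proj1 (lt_e _ _ _ qt)); rewrite /C; lra.
- by apply: (proj1 (lt_e _ _ _ at_)); rewrite /C; lra.
- by apply: (proj1 (lt_e _ _ _ bt)); rewrite /C; lra.
Qed.

(** A local error bound: what the calmness assumptions on [M_VI] and [M_QVI] have
    in common, and all that convergence needs from them. *)
Definition residual_bound : Prop :=
  exists C e : R, [/\ 0 <= C, 0 < e & forall x y xh, subproblem x y xh ->
    enorm (xh - dual_dir x y xh - xbar) < e ->
    enorm (r *: primal_dir x y xh) < e -> enorm (dual_dir x y xh) < e ->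
    enorm (xh - xbar) <=
      C * (enorm (primal_dir x y xh) + enorm (dual_dir x y xh))].

(** The second perturbation [xh - b - xbar] contains the error [xh - xbar] itself,
    with factor [Lq]; [Lq < 1] lets it be absorbed on the left. *)
Lemma calm_VI_residual (Lp Lq : R) : 0 <= Lp -> 0 <= Lq -> Lq < 1 ->
  single_valued_calm (M_VI F K) xbar Lp Lq -> QVI_sol F K xbar ->
  residual_bound.
Proof.
move=> Lp_ge0 Lq_ge0 Lq_lt1 calm sol.
have Mbar : M_VI F K 0 xbar xbar.
  by apply/plus_normal_coneP; rewrite add0r subr0; exact: sol.
have [e e_gt0 bnd] := calm_bound calm Mbar.
have D_gt0 : 0 < 1 - Lq by rewrite subr_gt0.
exists ((Lp * r + Lq) / (1 - Lq)), e; split => //.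
  by rewrite divr_ge0 ?(ltW D_gt0) // addr_ge0 // mulr_ge0 // ltW.
move=> x y xh sub qe ae _.
have [_ /(_ _ (subproblem_VI sub))] := bnd _ _ ae qe.
rewrite addrAC enormZ gtr0_norm // => h.
rewrite mulrAC ler_pdivlMr //.
have := ler_wpM2l Lq_ge0 (enormB (xh - xbar) (dual_dir x y xh)).
have := mulr_ge0 (mulr_ge0 Lp_ge0 (ltW r_gt0)) (enorm_ge0 (dual_dir x y xh)).
have := mulr_ge0 Lq_ge0 (enorm_ge0 (primal_dir x y xh)).
by move: h; lra.
Qed.

Lemma M_QVI_solP x : M_QVI F K 0 0 x <-> QVI_sol F K x.
Proof. by rewrite /M_QVI /= plus_normal_coneP !(add0r, addr0, subr0). Qed.

(** Solutions of the QVI are the values of [M_QVI 0 0], which is a singleton. *)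
Lemma calm_QVI_unique (Lp Lq : R) w :
  single_valued_calm (M_QVI F K) 0 Lp Lq ->
  QVI_sol F K xbar -> QVI_sol F K w -> w = xbar.
Proof.
move=> calm /M_QVI_solP Mbar /M_QVI_solP Mw.
have [e e_gt0 bnd] := calm_bound calm Mbar.
have e0 : enorm (0 : 'rV[R]_n) < e by rewrite enorm0.
have [|_ /(_ w Mw)] := bnd 0 0 e0; first by rewrite subr0.
rewrite subr0 enorm0 !mulr0 addr0 => w_le0; apply: subr0_eq.
by apply: enorm_eq0; apply/eqP; rewrite eq_le w_le0 enorm_ge0.
Qed.

Lemma calm_QVI_residual (Lp Lq : R) : 0 <= Lp -> 0 <= Lq ->
  single_valued_calm (M_QVI F K) 0 Lp Lq -> QVI_sol F K xbar ->
  residual_bound.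
Proof.
move=> Lp_ge0 Lq_ge0 calm /M_QVI_solP Mbar.
have [e e_gt0 bnd] := calm_bound calm Mbar.
exists (Lp * r + Lq), e; split => //.
  by rewrite addr_ge0 // mulr_ge0 // ltW.
move=> x y xh sub _ ae be.
have be' : enorm (- dual_dir x y xh - 0) < e by rewrite subr0 enormN.
have [_ /(_ _ (subproblem_QVI sub))] := bnd _ _ ae be'.
rewrite subr0 enormN enormZ gtr0_norm // => h.
have := mulr_ge0 (mulr_ge0 Lp_ge0 (ltW r_gt0)) (enorm_ge0 (dual_dir x y xh)).
have := mulr_ge0 Lq_ge0 (enorm_ge0 (primal_dir x y xh)).
by move: h; lra.
Qed.

Definition descends (c d : R) : Prop :=
  forall x y, lyapunov x y < d -> subproblem x y !=set0 /\
    forall xh, subproblem x y xh ->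
      c * (enorm (primal_dir x y xh) ^+ 2 + enorm (dual_dir x y xh) ^+ 2) <=
      lyapunov x y - lyapunov (next_x x y xh) (next_y x y xh).

Lemma local_descent (mu mu_perp : R) U :
    lx < 2 * (1 - r * mu) -> ly < 2 * (1 - mu_perp / r) ->
    semimonotone (T_map F K) (diag_space n) mu_perp mu (row_mx xbar xbar) 0 U ->
    local_solvability ->
  exists c d : R, [/\ 0 < c, 0 < d & descends c d].
Proof.
move=> lx_lt ly_lt semi local.
have [e e_gt0 ineq] := semimonotone_local semi.
have [d d_gt0 {}local] := local e e_gt0.
pose ca := (2 * (1 - r * mu) - lx) / 4.
pose cb := (2 * (1 - mu_perp / r) - ly) / 4.
have ca_gt0 : 0 < ca by rewrite divr_gt0 // subr_gt0.
have cb_gt0 : 0 < cb by rewrite divr_gt0 // subr_gt0.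
exists (Num.min ca cb), d; split=> //; first by rewrite lt_min ca_gt0.
move=> x y /local[nonempty xh_near]; split=> // xh sub.
have [xhe qe ae be] := xh_near _ sub.
have := ineq _ _ _ (subproblem_inclusion sub) xhe qe.
rewrite enormN subKr => /(_ ae)/lyapunov_step; rewrite !sqr_enorm -/ca -/cb.
have : Num.min ca cb <= ca by rewrite ge_min lexx.
have : Num.min ca cb <= cb by rewrite ge_min lexx orbT.
move=> /(ler_wpM2r (dotv_ge0 (dual_dir x y xh))) h1.
move=> /(ler_wpM2r (dotv_ge0 (primal_dir x y xh))) h2.
by move: h1 h2; rewrite mulrDr; lra.
Qed.

(** * Existence and convergence of runs *)

Lemma pdQVI_runP x0 y0 (x y xh : nat -> 'rV[R]_n) :
  pdQVI_run F K r lx ly x0 y0 x y xh <->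
  [/\ x 0%N = x0, y 0%N = y0 & forall k,
    [/\ subproblem (x k) (y k) (xh k),
        x k.+1 = next_x (x k) (y k) (xh k) &
        y k.+1 = next_y (x k) (y k) (xh k)]].
Proof.
have nextE k : next_x (x k) (y k) (xh k) =
    (1 - lx) *: x k + lx *: (2^-1 *: (xh k + x k - r^-1 *: y k)).
  rewrite /next_x /primal_dir; apply/rowP => i; rewrite !mxE.
  by field; rewrite gt_eqF.
have nextyE k : next_y (x k) (y k) (xh k) =
    y k - ly *: ((r / 2) *: (xh k - x k + r^-1 *: y k)).
  rewrite /next_y /dual_dir; apply/rowP => i; rewrite !mxE.
  by field; rewrite gt_eqF.
by split=> -[x0E y0E step]; split=> // k; have [? ? ?] := step k;
   rewrite ?nextE ?nextyE in step *; split; rewrite // -?nextE -?nextyE.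
Qed.

(** Choosing any solution of each subproblem never gets stuck, since descent keeps
    the iterates in the sublevel set where subproblems are solvable. *)
Lemma run_exists (c d : R) x0 y0 : 0 < c -> descends c d ->
  lyapunov x0 y0 < d ->
  exists x y xh : nat -> 'rV[R]_n, pdQVI_run F K r lx ly x0 y0 x y xh.
Proof.
move=> c_gt0 desc lyap0.
pose sol (z : 'rV[R]_n * 'rV[R]_n) := get (subproblem z.1 z.2).
pose step z := (next_x z.1 z.2 (sol z), next_y z.1 z.2 (sol z)).
pose z k := iter k step (x0, y0).
have z_lt k : lyapunov (z k).1 (z k).2 < d.
  elim: k => [//|k IHk]; have [/getPex sub dec] := desc _ _ IHk.
  apply: le_lt_trans IHk; rewrite -subr_ge0; apply: le_trans (dec _ sub).
  by rewrite mulr_ge0 ?(ltW c_gt0) // addr_ge0 // sqr_ge0.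
exists (fun k => (z k).1), (fun k => (z k).2), (sol \o z); apply/pdQVI_runP.
by split=> // k; have [/getPex sub _] := desc _ _ (z_lt k).
Qed.

(** [|x k - xbar|^2] is at most a constant times the decrease [v k - v k.+1] of the
    Lyapunov values, and the decrease of a convergent sequence tends to [0]. *)
Lemma run_cvg (c d : R) : local_solvability -> 0 < c -> descends c d ->
    residual_bound -> 0 < d ->
  exists2 d' : R, 0 < d' & forall x0 y0 (x y xh : nat -> 'rV[R]_n),
    lyapunov x0 y0 < d' -> pdQVI_run F K r lx ly x0 y0 x y xh ->
    x @ \oo --> xbar.
Proof.
move=> local c_gt0 desc [C [e [C_ge0 e_gt0 bnd]]] d_gt0.
have [d1 d1_gt0 {}local] := local e e_gt0.
exists (Num.min d d1) => [|x0 y0 x y xh lyap0]; first by rewrite lt_min d_gt0.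
move=> /pdQVI_runP[x0E y0E step].
pose v k := lyapunov (x k) (y k).
have dec k : v k < d -> c * (enorm (primal_dir (x k) (y k) (xh k)) ^+ 2
    + enorm (dual_dir (x k) (y k) (xh k)) ^+ 2) <= v k - v k.+1.
  move=> /desc[_ h]; have [sub xE yE] := step k.
  by rewrite /v xE yE; apply: h.
have v_lt k : v k < Num.min d d1.
  elim: k => [|k IHk]; first by rewrite /v x0E y0E.
  apply: le_lt_trans (IHk); rewrite -subr_ge0; apply: le_trans (dec k _).
    by rewrite mulr_ge0 ?(ltW c_gt0) // addr_ge0 // sqr_ge0.
  by move: IHk; rewrite lt_min => /andP[].
have {}dec k : c * (enorm (primal_dir (x k) (y k) (xh k)) ^+ 2
    + enorm (dual_dir (x k) (y k) (xh k)) ^+ 2) <= v k - v k.+1.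
  by apply: dec; move: (v_lt k); rewrite lt_min => /andP[].
have v_noninc : {homo v : m k / (m <= k)%N >-> k <= m}.
  apply/nonincreasing_seqP => k; rewrite -subr_ge0; apply: le_trans (dec k).
  by rewrite mulr_ge0 ?(ltW c_gt0) // addr_ge0 // sqr_ge0.
have v_cvg : cvgn v.
  apply: nonincreasing_is_cvgn => //.
  by exists 0 => _ [k _ <-]; apply: lyapunov_ge0.
have diff0 : (v k - v k.+1) @[k --> \oo] --> 0.
  rewrite -(subrr (limn v)); apply: cvgB => //.
  by rewrite (cvg_shiftS v).
have x_bnd k : c * enorm (x k - xbar) ^+ 2 <=
    2 * (C + 1) ^+ 2 * (v k - v k.+1).
  have [sub _ _] := step k.
  have v_lt1 : v k < d1 by move: (v_lt k); rewrite lt_min => /andP[].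
  have [_ /(_ _ sub)[_ qe ae be]] := local _ _ v_lt1.
  have xhb := bnd _ _ _ sub qe ae be.
  have := dec k; set a := primal_dir _ _ _ in xhb *.
  set b := dual_dir _ _ _ in xhb * => deck.
  have xb : enorm (x k - xbar) <= (C + 1) * (enorm a + enorm b).
    have -> : x k - xbar = xh k - xbar - 2^-1 *: (a + b).
      by rewrite -sub_primal_dir; apply/rowP => i; rewrite !mxE; ring.
    have := enormB (xh k - xbar) (2^-1 *: (a + b)).
    have := enormD a b; rewrite enormZ ger0_norm ?invr_ge0 //.
    have := enorm_ge0 a; have := enorm_ge0 b.
    by lra.
  have xb2 : enorm (x k - xbar) ^+ 2 <= ((C + 1) * (enorm a + enorm b)) ^+ 2.
    by rewrite lerXn2r // nnegrE ?mulr_ge0 ?addr_ge0 ?enorm_ge0.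
  have ab2 : (enorm a + enorm b) ^+ 2 <= 2 * (enorm a ^+ 2 + enorm b ^+ 2).
    by have := sqr_ge0 (enorm a - enorm b); rewrite sqrrB sqrrD; lra.
  have C2_ge0 : 0 <= (C + 1) ^+ 2 by exact: sqr_ge0.
  apply: (le_trans (ler_wpM2l (ltW c_gt0) xb2)); rewrite exprMn.
  have := ler_wpM2l (ltW c_gt0) (ler_wpM2l C2_ge0 ab2).
  by have := ler_wpM2l C2_ge0 deck; lra.
move=> A /nbhs_enorm[t t_gt0 tA].
have M_gt0 : 0 < 2 * (C + 1) ^+ 2 by rewrite mulr_gt0 // exprn_gt0 // ltr_wpDl.
have s_gt0 : 0 < c * t ^+ 2 / (2 * (C + 1) ^+ 2).
  by rewrite divr_gt0 // mulr_gt0 // exprn_gt0.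
move/cvgr0Pnorm_lt: diff0 => /(_ _ s_gt0); apply: filterS => k diff_lt.
apply: tA; rewrite -(ltr_pXn2r (n := 2)) ?nnegrE ?enorm_ge0 ?(ltW t_gt0) //.
rewrite -(ltr_pM2l c_gt0) (le_lt_trans (x_bnd k)) // mulrC -ltr_pdivlMr //.
exact: le_lt_trans (ler_norm _) diff_lt.
Qed.

End Step.

Theorem theorem6p5 (R : realType) (n : nat)
  (F : 'rV[R]_n -> 'rV[R]_n) (K : 'rV[R]_n -> set 'rV[R]_n) (xbar : 'rV[R]_n)
  (mu mu_perp r lx ly : R)
  (F_mono : monotone_map F)
  (K_isc : inner_semicontinuous K)
  (K_gph : closed (gph K))
  (K_closed : forall u, closed (K u))
  (K_convex : forall u, convex_set (M := 'rV[R]_n) (K u))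
  (xbar_sol : QVI_sol F K xbar)
  (mu_gt0 : 0 < mu) (mu_perp_gt0 : 0 < mu_perp) (mu_lt1 : mu * mu_perp < 1)
  (T_semi : exists U : set ('rV[R]_(n + n) * 'rV[R]_(n + n)),
     semimonotone (T_map F K) (diag_space n) mu_perp mu (row_mx xbar xbar) 0 U)
  (r_bnd : mu_perp < r < mu^-1)
  (lx_bnd : 0 < lx < 2 * (1 - r * mu))
  (ly_bnd : 0 < ly < 2 * (1 - mu_perp / r))
  (Mr_calm : exists Lp Lq : R,
     [/\ 0 <= Lp, 0 <= Lq & single_valued_calm (M_reg F K r xbar) xbar Lp Lq]) :
  \forall z0 \near (xbar, 0 : 'rV[R]_n),
    (exists x y xh, pdQVI_run F K r lx ly z0.1 z0.2 x y xh) /\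
    forall x y xh : nat -> 'rV[R]_n,
      pdQVI_run F K r lx ly z0.1 z0.2 x y xh ->
      ((exists Lp Lq : R,
          [/\ 0 <= Lp, 0 <= Lq, Lq < 2^-1 &
              single_valued_calm (M_VI F K) xbar Lp Lq]) ->
        ((exists k, QVI_sol F K (x k)) \/
         (bounded_fun x /\ cluster (x @ \oo) `<=` QVI_sol F K)) /\
        ((\forall w \near xbar, QVI_sol F K w -> w = xbar) ->
         x @ \oo --> xbar)) /\
      ((exists Lp Lq : R,
          [/\ 0 <= Lp, 0 <= Lq, Lq < 1 &
              single_valued_calm (M_QVI F K) 0 Lp Lq]) ->
        ((exists k, x k = xbar) \/ x @ \oo --> xbar) /\
        (\forall w \near xbar, QVI_sol F K w -> w = xbar)).
Proof.
have [Lp [Lq [Lp_ge0 Lq_ge0 calm]]] := Mr_calm.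
have [U semi] := T_semi.
have [lx_gt0 lx_lt] := andP lx_bnd; have [ly_gt0 ly_lt] := andP ly_bnd.
have [rmu _] := andP r_bnd; have r_gt0 := lt_trans mu_perp_gt0 rmu.
have local := subproblem_local r_gt0 lx_gt0 ly_gt0 Lp_ge0 Lq_ge0 calm xbar_sol.
have [c [d [c_gt0 d_gt0 desc]]] :=
  local_descent r_gt0 lx_gt0 ly_gt0 lx_lt ly_lt semi local.
have lyap_near := lyapunov_near xbar r_gt0 lx_gt0 ly_gt0.
have run_near := run_cvg r_gt0 lx_gt0 ly_gt0 local c_gt0 desc.
have near_VI : (exists Lp Lq : R, [/\ 0 <= Lp, 0 <= Lq, Lq < 2^-1 &
      single_valued_calm (M_VI F K) xbar Lp Lq]) ->
    \forall z0 \near (xbar, 0 : 'rV[R]_n), forall x y xh : nat -> 'rV[R]_n,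
      pdQVI_run F K r lx ly z0.1 z0.2 x y xh -> x @ \oo --> xbar.
  move=> [lp [lq [lp_ge0 lq_ge0 lq_lt calmVI]]].
  have lq1 : lq < 1 by lra.
  have [d' d'_gt0 cvg_run] :=
    run_near (calm_VI_residual r_gt0 lp_ge0 lq_ge0 lq1 calmVI xbar_sol) d_gt0.
  by apply: filterS (lyap_near _ d'_gt0) => z0 ? x y xh; apply: cvg_run.
have near_QVI : (exists Lp Lq : R, [/\ 0 <= Lp, 0 <= Lq, Lq < 1 &
      single_valued_calm (M_QVI F K) 0 Lp Lq]) ->
    \forall z0 \near (xbar, 0 : 'rV[R]_n), forall x y xh : nat -> 'rV[R]_n,
      pdQVI_run F K r lx ly z0.1 z0.2 x y xh -> x @ \oo --> xbar.
  move=> [lp [lq [lp_ge0 lq_ge0 _ calmQVI]]].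
  have [d' d'_gt0 cvg_run] :=
    run_near (calm_QVI_residual r_gt0 lp_ge0 lq_ge0 calmQVI xbar_sol) d_gt0.
  by apply: filterS (lyap_near _ d'_gt0) => z0 ? x y xh; apply: cvg_run.
(* The neighborhood of starting points must be chosen before the calmness
   assumptions of the two parts are made; this is possible because they do not
   depend on the starting point. *)
have imp_near (P : Prop) (Q : 'rV[R]_n * 'rV[R]_n -> Prop) :
    (P -> \forall z \near (xbar, 0 : 'rV[R]_n), Q z) ->
    \forall z \near (xbar, 0 : 'rV[R]_n), P -> Q z.
  move=> PQ; have [p|np] := pselect P; last first.
    by apply: (@filterE _ (nbhs (xbar, 0 : 'rV[R]_n))) => z /np.
  by apply: filterS (PQ p) => z.
apply: filterS3 (lyap_near _ d_gt0) (imp_near _ _ near_VI)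
  (imp_near _ _ near_QVI) => z0 z0d cvg_VI cvg_QVI.
split; first exact: (run_exists r_gt0 c_gt0 desc z0d).
move=> x y xh run; split=> [calmVI|calmQVI].
  have x_cvg := cvg_VI calmVI _ _ _ run.
  split; last by [].
  right; split; first by apply: cvg_seq_bounded; apply/cvg_ex; exists xbar.
  move=> w /(cvg_cluster x_cvg)/norm_hausdorff <-; exact: xbar_sol.
have x_cvg := cvg_QVI calmQVI _ _ _ run.
split; first by right.
apply: (@filterE _ (nbhs xbar)) => w w_sol.
have [lp [lq [_ _ _ calmQ]]] := calmQVI.
exact: (calm_QVI_unique calmQ xbar_sol w_sol).
Qed.
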